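(* Let $\mathcal{E},\mathcal{E}'$ be coarse structures on a set $X$ such that $\mathcal{B}^\sharp_{(X,\mathcal{E})}=\mathcal{B}^\sharp_{(X,\mathcal{E}')}$ and $\|_{(X,\mathcal{E})}=\|_{(X,\mathcal{E}')}$. Then $(X,\mathcal{E})$ and $(X,\mathcal{E}')$ are $\delta$-equivalent. If, in addition, $\mathcal{B}^\sharp_{(X,\mathcal{E})}$ is finite, then $\mathcal{E}=\mathcal{E}'$.
   Context: A coarse structure on a set $X$ is a family $\mathcal{E}$ of subsets of $X\times X$ such that: each $E\in\mathcal{E}$ contains the diagonal $\triangle_X=\{(x,x):x\in X\}$; if $E,E'\in\mathcal{E}$ then $E\circ E'\in\mathcal{E}$ and $E^{-1}\in\mathcal{E}$, where $E\circ E'=\{(x,y):\exists z\,((x,z)\in E,\ (z,y)\in E')\}$ and $E^{-1}=\{(y,x):(x,y)\in E\}$; if $E\in\mathcal{E}$ and $\triangle_X\subseteq E'\subseteq E$ then $E'\in\mathcal{E}$; and $\bigcup\mathcal{E}=X\times X$. The pair $(X,\mathcal{E})$ is called a ballean (or coarse space). For $E\in\mathcal{E}$, $x\in X$, $A\subseteq X$: $E[x]=\{y\in X:(x,y)\in E\}$ and $E[A]=\bigcup_{a\in A}E[a]$. A subset $B\subseteq X$ is bounded if $B\subseteq E[x]$ for some $E\in\mathcal{E}$, $x\in X$. Subsets $A,B$ of $X$ are close, written $A\,\delta_{(X,\mathcal{E})}\,B$, if there is $E\in\mathcal{E}$ with $A\subseteq E[B]$ and $B\subseteq E[A]$. Balleans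 $(X,\mathcal{E})$, $(X,\mathcal{E}')$ are $\delta$-equivalent if $\delta_{(X,\mathcal{E})}=\delta_{(X,\mathcal{E}')}$. $\mathcal{B}^\sharp_{(X,\mathcal{E})}$ denotes the set of all ultrafilters $\varphi$ on $X$ such that $X\setminus B\in\varphi$ for each bounded subset $B$ of $(X,\mathcal{E})$. Ultrafilters $p,q\in\mathcal{B}^\sharp_{(X,\mathcal{E})}$ are parallel, written $p\,\|_{(X,\mathcal{E})}\,q$, if there is $E\in\mathcal{E}$ such that $E[P]\in q$ for each $P\in p$; this is an equivalence relation on $\mathcal{B}^\sharp_{(X,\mathcal{E})}$. *)

(* Defs.v *)
From mathcomp Require Import all_boot.
From mathcomp Require Import mathcomp_extra boolp classical_sets functions.
From mathcomp Require Import cardinality filter.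

Set Implicit Arguments.
Unset Strict Implicit.
Unset Printing Implicit Defensive.

Local Open Scope classical_set_scope.
Local Open Scope relation_scope.

Section Coarse.
Variable X : Type.
Implicit Types (Ec : set_system (X * X)) (E F : set (X * X)).
Implicit Types (A B P : set X) (p q : set_system X).

(* In the library [F \; E] is the set of (x, y) such that (x, z) \in E and
   (z, y) \in F for some z, so it is written E o F in coarse geometry.
   The clause [coarse_neq0] follows from [coarse_cover] as soon as X is
   inhabited; for X empty it only rules out the empty family, leaving
   { diagonal } as the unique coarse structure on the empty set. *)
Record coarse_structure Ec : Prop := {
  coarse_neq0 : Ec !=set0;
  coarse_diag : forall E, Ec E -> diagonal `<=` E;
  coarse_comp : forall E F, Ec E -> Ec F -> Ec (F \; E);
  coarse_inv : forall E, Ec E -> Ec (E^-1);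
  coarse_down : forall E F, Ec E -> diagonal `<=` F -> F `<=` E -> Ec F;
  coarse_cover : \bigcup_(E in Ec) E = [set: X * X] }.

(* E[A]; the ball E[x] is [xsection E x]. *)
Definition eball E A : set X := \bigcup_(a in A) xsection E a.

Definition bounded_in Ec B : Prop :=
  exists E x, Ec E /\ B `<=` xsection E x.

Definition delta Ec : set (set X * set X) :=
  [set AB | exists E,
     [/\ Ec E, AB.1 `<=` eball E AB.2 & AB.2 `<=` eball E AB.1]].

Definition delta_equivalent Ec Ec' : Prop := delta Ec = delta Ec'.

Definition Bsharp Ec : set (set_system X) :=
  [set phi | UltraFilter phi /\ forall B, bounded_in Ec B -> phi (~` B)].

(* A relation on [Bsharp Ec]: both arguments are required to lie in it. *)
Definition parallel Ec : set (set_system X * set_system X) :=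
  [set pq | [/\ Bsharp Ec pq.1, Bsharp Ec pq.2 &
     exists E, Ec E /\ forall P, pq.1 P -> pq.2 (eball E P)]].

End Coarse.

(* Main.v *)
(** A set is bounded iff no ultrafilter of [Bsharp Ec] contains it, so both
    structures have the same bounded sets.  For nonempty [B], [A] is contained
    in some [E[B]] iff every [p] in [Bsharp Ec] containing [A] is parallel to
    some [q] containing [B]: if all the sets [A `\` E[B]] are unbounded, they
    lie in a common [p], which is parallel to no [q] containing [B].  Hence
    [delta Ec] is determined by [Bsharp Ec] and [parallel Ec].

    If [Bsharp Ec] is finite and [E] in [Ec] lies in no member of [Ec'], take an
    ultrafilter [r] on [X * X] containing every [E `\` E''] with [E''] in [Ec'].
    Its projections [p], [q] lie in [Bsharp Ec] and are parallel, say through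
    [G] in [Ec'].  Choose [Q] in [q] that lies in no other member of
    [Bsharp Ec].  For [r]-almost all [(x, y)] there is [y'] in [Q] with
    [G (x, y')], and for [y] outside a bounded subset of [Q] necessarily
    [y' = y], because [y] and [y'] are linked by the relation [G o E^-1], which
    preserves boundedness.  Hence [G] is in [r], a contradiction. *)
Require Import Defs.
From mathcomp Require Import all_boot.
From mathcomp Require Import mathcomp_extra boolp classical_sets functions.
From mathcomp Require Import cardinality filter.

Set Implicit Arguments.
Unset Strict Implicit.
Unset Printing Implicit Defensive.

Local Open Scope classical_set_scope.
Local Open Scope relation_scope.

(** * Ultrafilters on a set *)

Lemma ultra_disjoint (T : Type) (p : set_system T) (A B : set T) :
  UltraFilter p -> p A -> p B -> A `&` B !=set0.
Proof. by move=> pU pA pB; apply: (@filter_ex _ p); exact: filterI. Qed.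

Lemma ultraP (T : Type) (p : set_system T) :
  ProperFilter p -> (forall A, p A \/ p (~` A)) -> UltraFilter p.
Proof.
move=> pF pA; split=> // G GF pG; apply/seteqP; split=> // A GA.
have [//|/pG GnA] := pA A.
by have [x []] := @filter_ex _ G _ _ (filterI GA GnA).
Qed.

Lemma ultra_fmap (T U : Type) (f : T -> U) (p : set_system T) :
  UltraFilter p -> UltraFilter [set A | p (f @^-1` A)].
Proof.
move=> pU; apply: ultraP => A; exact: (in_ultra_setVsetC (f @^-1` A)).
Qed.

(** Induction on an enumeration of [S]: by maximality of [p], each [q] other than [p] misses some
    set of [p], and [P] is the intersection of these finitely many sets. *)
Lemma ultra_isolated (T : Type) (S : set (set_system T)) (p : set_system T) :
    finite_set S -> (forall q, S q -> UltraFilter q) -> UltraFilter p ->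
  exists2 P, p P & forall q, S q -> q P -> q = p.
Proof.
move=> /finite_seqP[s ->] sU pU.
elim: s sU => [_|q s IHs sU]; first by exists setT => //; exact: filterT.
have [|P pP isoP] := IHs.
  by move=> q' q's; apply: sU; rewrite /= inE q's orbT.
have qU : UltraFilter q by apply: sU; rewrite /= inE eqxx.
have [->|neq] := pselect (q = p).
  by exists P => // q'; rewrite /= inE => /predU1P[-> //|]; exact: isoP.
have [A pA nqA] : exists2 A, p A & ~ q A.
  apply: contrapT => nA; apply: neq; apply: max_filter => A pA.
  by apply: contrapT => nqA; apply: nA; exists A.
exists (P `&` A); first exact: filterI.
move=> q' sq' q'PA; have q'U := sU _ sq'.
move: sq'; rewrite /= inE => /predU1P[q'q|q's].
  by case: nqA; rewrite -q'q; apply: filterS q'PA => x [].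
by apply: isoP => //; apply: filterS q'PA => x [].
Qed.

(** * Bounded sets of a coarse structure *)

Section Bornology.
Variables (X : Type) (Ec : set_system (X * X)).
Hypothesis hEc : coarse_structure Ec.
Implicit Types (E F : set (X * X)) (A B P : set X) (p q : set_system X).

Lemma eballP E A y : eball E A y <-> exists2 a, A a & E (a, y).
Proof. by split=> -[a Aa /xsectionP aEy]; exists a => //; apply/xsectionP. Qed.

Lemma coarse_refl E x : Ec E -> E (x, x).
Proof. by move=> EcE; apply: (coarse_diag hEc EcE); exact/diagonalP. Qed.

(** As [E] and [F] contain the diagonal, their composition contains both. *)
Lemma coarse_supU E F : Ec E -> Ec F -> exists2 G, Ec G & E `|` F `<=` G.
Proof.
move=> EcE EcF; exists (F \; E); first exact: (coarse_comp hEc).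
move=> [x y] [xEy|xFy]; [exists y|exists x] => //.
- exact: coarse_refl.
- exact: coarse_refl.
Qed.

Lemma coarse_pair x y : exists2 E, Ec E & E (x, y).
Proof.
have : (\bigcup_(E in Ec) E) (x, y) by rewrite coarse_cover.
by case=> E EcE xEy; exists E.
Qed.

Lemma bounded_sub A B : A `<=` B -> bounded_in Ec B -> bounded_in Ec A.
Proof.
by move=> AB [E [x [EcE BE]]]; exists E, x; split=> // y /AB /BE.
Qed.

Lemma bounded_set1 x : bounded_in Ec [set x].
Proof.
have [E EcE xEx] := coarse_pair x x.
by exists E, x; split=> // _ ->; apply/xsectionP.
Qed.

Lemma bounded_setU A B :
  bounded_in Ec A -> bounded_in Ec B -> bounded_in Ec (A `|` B).
Proof.
move=> [E [x [EcE AE]]] [F [y [EcF BF]]].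
have [G EcG xGy] := coarse_pair x y.
have [H EcH EFG] := coarse_supU EcE (coarse_comp hEc EcG EcF).
exists H, x; split=> // z [/AE|/BF] /xsectionP h; apply/xsectionP/EFG.
- by left.
- by right; exists y.
Qed.

Lemma bounded_eball E B :
  Ec E -> bounded_in Ec B -> bounded_in Ec (eball E B).
Proof.
move=> EcE [F [x [EcF BF]]]; exists (E \; F), x; split.
  exact: (coarse_comp hEc).
by move=> y /eballP[b /BF/xsectionP xFb bEy]; apply/xsectionP; exists b.
Qed.

Lemma bounded_setX B :
  bounded_in Ec B -> exists2 E, Ec E & B `*` B `<=` E.
Proof.
move=> [E [x [EcE BE]]]; exists (E \; E^-1).
  by apply: (coarse_comp hEc) => //; exact: (coarse_inv hEc).
by move=> [y z] /= [/BE/xsectionP xEy /BE/xsectionP xEz]; exists x.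
Qed.

(** * Ultrafilters of unbounded sets and parallelism *)

Lemma Bsharp_unbounded p A : Bsharp Ec p -> p A -> ~ bounded_in Ec A.
Proof.
by move=> [pU pb] pA /pb pnA; have [x []] := ultra_disjoint pU pA pnA.
Qed.

(** The differences of a set of [S] and a bounded set form a base of a proper filter, and any
    ultrafilter above it will do. The point [x0] serves to make the empty set bounded. *)
Lemma Bsharp_extend (x0 : X) (S : set_system X) :
    S !=set0 ->
    (forall A B, S A -> S B -> exists2 C, S C & C `<=` A `&` B) ->
    (forall A, S A -> ~ bounded_in Ec A) ->
  exists2 p, Bsharp Ec p & S `<=` p.
Proof.
move=> [A0 SA0] SI Sub.
pose D := [set AB : set X * set X | S AB.1 /\ bounded_in Ec AB.2].
pose G := filter_from D (fun AB => AB.1 `\` AB.2).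
have b0 : bounded_in Ec set0 by apply: bounded_sub (bounded_set1 x0).
have GF : ProperFilter G.
  apply: filter_from_proper => [|[A B] /= [SA bB]].
    apply: filter_from_filter => [|[A B] [A' B'] [SA bB] [SA' bB']].
      by exists (A0, set0).
    have [C SC CA] := SI _ _ SA SA'.
    exists (C, B `|` B'); first by split=> //; exact: bounded_setU.
    move=> x [/= Cx nBx]; have [Ax A'x] := CA _ Cx.
    by split; split=> // h; apply: nBx; [left|right].
  apply: contrapT => AB0; apply: (Sub _ SA); apply: bounded_sub bB => x Ax.
  by apply: contrapT => nBx; apply: AB0; exists x.
have [p [pU Gp]] := ultraFilterLemma GF.
exists p; first split=> // B bB.
  by apply: Gp; exists (A0, B) => // x [].
by move=> A SA; apply: Gp; exists (A, set0) => // x [].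
Qed.

Lemma unbounded_Bsharp (x0 : X) A :
  ~ bounded_in Ec A -> exists2 p, Bsharp Ec p & p A.
Proof.
move=> nbA; have [||_ -> //|p Bp Ap] := @Bsharp_extend x0 [set A].
- by exists A.
- by move=> _ _ -> ->; exists A.
- by exists p => //; exact: Ap.
Qed.

Lemma Bsharp_transfer E p q : Ec E -> Bsharp Ec p -> UltraFilter q ->
  (forall P, p P -> q (eball E P)) -> Bsharp Ec q.
Proof.
move=> EcE [pU pb] qU Epq; split=> // B bB.
have [qB|//] := in_ultra_setVsetC B qU.
have /pb/Epq qE := bounded_eball (coarse_inv hEc EcE) bB.
have [y [By /eballP[x nx xEy]]] := ultra_disjoint qU qB qE.
by case: nx; apply/eballP; exists y.
Qed.

(** A set disjoint from [eball E^-1 Q] has its [E]-image disjoint from [Q]. This gives the symmetry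
    of parallelism. *)
Lemma eball_inv E p q : UltraFilter p -> UltraFilter q ->
    (forall P, p P -> q (eball E P)) ->
  forall Q, q Q -> p (eball E^-1 Q).
Proof.
move=> pU qU Epq Q qQ.
have [//|/Epq qE] := in_ultra_setVsetC (eball E^-1 Q) pU.
have [y [Qy /eballP[x nx xEy]]] := ultra_disjoint qU qQ qE.
by case: nx; apply/eballP; exists y.
Qed.

Lemma eball_cover_parallel A B : B !=set0 ->
  (exists2 E, Ec E & A `<=` eball E B) <->
  (forall p, Bsharp Ec p -> p A -> exists2 q, parallel Ec (p, q) & q B).
Proof.
move=> [b Bb]; split=> [[E EcE AE] p Bp pA|ABpar].
  have pU := Bp.1.
  (* [D P] is nonempty because a point of [A] in [P] lies in the [E]-ball of some point of [B]. An
     ultrafilter above these sets contains [B] and is parallel to [p] through [E^-1]. *)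
  pose D P := eball E^-1 P `&` B.
  have DF : ProperFilter (filter_from p D).
    apply: filter_from_proper => [|P pP].
      apply: filter_from_filter => [|P Q pP pQ].
        by exists setT; exact: filterT.
      exists (P `&` Q); first exact: filterI.
      move=> x [/eballP[y [Py Qy] yEx] Bx].
      by split; split=> //; apply/eballP; exists y.
    have [x [Ax Px]] := ultra_disjoint pU pA pP.
    have /eballP[y By yEx] := AE _ Ax.
    by exists y; split=> //; apply/eballP; exists x.
  have [q [qU Dq]] := ultraFilterLemma DF.
  have Epq P : p P -> q (eball E^-1 P).
    by move=> pP; apply: Dq; exists P => // x [].
  exists q; last by apply: Dq; exists setT => [|x []//]; exact: filterT.
  have EcV := coarse_inv hEc EcE.
  by split=> //; [exact: Bsharp_transfer Epq|exists E^-1].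
have [E EcE bAE] : exists2 E, Ec E & bounded_in Ec (A `\` eball E B).
  apply: contrapT => nb.
  have [|||p Bp Sp] := @Bsharp_extend b [set A `\` eball E B | E in Ec].
  - by have [E EcE] := coarse_neq0 hEc; exists (A `\` eball E B), E.
  - move=> _ _ [E EcE <-] [F EcF <-].
    have [G EcG EFG] := coarse_supU EcE EcF.
    exists (A `\` eball G B); first by exists G.
    move=> x [Ax nGx]; split; split=> // /eballP[y By h]; apply: nGx.
    + by apply/eballP; exists y => //; apply: EFG; left.
    + by apply/eballP; exists y => //; apply: EFG; right.
  - by move=> _ [E EcE <-] bE; apply: nb; exists E.
  have pU := Bp.1.
  have [|q [/= _ [qU _] [E [EcE Epq]]] qB] := ABpar _ Bp.
    have [E EcE] := coarse_neq0 hEc.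
    have : p (A `\` eball E B) by apply: Sp; exists E.
    by apply: filterS => x [].
  have pE := eball_inv pU qU Epq qB.
  have pnE : p (A `\` eball E^-1 B).
    by apply: Sp; exists E^-1 => //; exact: (coarse_inv hEc).
  by have [x [? []]] := ultra_disjoint pU pE pnE.
(* The bounded remainder is absorbed into a ball around the single point [b] of [B]. *)
have [F EcF bF] := bounded_setX (bounded_setU bAE (bounded_set1 b)).
have [G EcG EFG] := coarse_supU EcE EcF.
exists G => // x Ax; apply/eballP.
have [/eballP[y By yEx]|nE] := pselect (eball E B x).
  by exists y => //; apply: EFG; left.
by exists b => //; apply: EFG; right; apply: bF; split; [right|left].
Qed.

(** Two complementary unbounded pieces of [P] would each lie in a member of [Bsharp Ec], which must
    be [p]; but [p] cannot contain disjoint sets. *)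
Lemma isolated_indecomposable p P : Bsharp Ec p -> p P ->
    (forall q, Bsharp Ec q -> q P -> q = p) ->
  forall A, A `<=` P -> bounded_in Ec A \/ bounded_in Ec (P `\` A).
Proof.
move=> Bp pP isoP A AP; have pU := Bp.1.
have [x0 _] := @filter_ex _ p _ _ pP.
have sub_p B : B `<=` P -> ~ bounded_in Ec B -> p B.
  move=> BP /(unbounded_Bsharp x0)[q Bq qB].
  rewrite -(isoP q) //; have qU := Bq.1.
  exact: filterS qB.
apply: contrapT => /not_orP[/(sub_p _ AP) pA /sub_p].
move=> /(_ (@subDsetl _ _ _)) pPA.
by have [x [Ax []]] := ultra_disjoint pU pA pPA.
Qed.

(* For a maximal [F]-independent subset [S] of the left-hand set [M], [M] is
   contained both in [S `|` eball F S] and in [N `|` eball F N], where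
   [N := P `\` S]; either [S] or [N] is bounded. *)
Lemma indecomposable_moved_bounded P F :
    (forall A, A `<=` P -> bounded_in Ec A \/ bounded_in Ec (P `\` A)) ->
    (forall x y, F (x, y) -> F (y, x)) ->
    (forall B, bounded_in Ec B -> bounded_in Ec (eball F B)) ->
  bounded_in Ec [set y | P y /\ exists z, [/\ P z, z <> y & F (y, z)]].
Proof.
move=> Pdec Fsym Fb; set M := [set y | _].
pose I := [set S | S `<=` M /\ forall a b, S a -> S b -> F (a, b) -> a = b].
have [|S [[SM Sind] Smax]] := @Zorn_bigcup X I.
  move=> C CI Ctot; split=> [|a b [S CS Sa] [S' CS' Sb]].
    by apply: bigcup_sub => S /CI[].
  have [SS'|S'S] := Ctot _ _ CS CS'.
  - by apply: (CI _ CS').2 => //; exact: SS'.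
  - by apply: (CI _ CS).2 => //; exact: S'S.
have SP : S `<=` P by move=> x /SM[].
have [bS|bN] := Pdec S SP.
  (* By maximality, a point of [M] outside [S] is [F]-related to a point of [S]. *)
  apply: bounded_sub (bounded_setU bS (Fb _ bS)) => y My.
  have [Sy|nSy] := pselect (S y); first by left.
  right; apply/eballP; apply: contrapT => nF; apply: (Smax (S `|` [set y])).
    split; first by left.
    by move=> /(_ y); apply: contra_not nSy; apply; right.
  have nE a : S a -> ~ F (a, y) by move=> Sa Fay; apply: nF; exists a.
  split=> [a [/SM//|->//]|a b [Sa|->] [Sb|->]] //.
  - exact: Sind.
  - by move=> /(nE _ Sa).
  - by move=> /Fsym/(nE _ Sb).
(* By independence, the partner [z] of a point [y] of [S] lies outside [S]. *)
apply: bounded_sub (bounded_setU bN (Fb _ bN)) => y [Py [z [Pz zy Fyz]]].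
have [Sy|nSy] := pselect (S y); last by left.
right; apply/eballP; exists z; last exact: Fsym.
by split=> // Sz; apply: zy; symmetry; exact: Sind.
Qed.

End Bornology.

(** * Comparison of two coarse structures *)

Lemma Bsharp_eq_bounded (X : Type) (Ec Ec' : set_system (X * X)) (B : set X) :
    coarse_structure Ec' -> Bsharp Ec = Bsharp Ec' ->
  bounded_in Ec B -> bounded_in Ec' B.
Proof.
move=> hEc' hB bB; have [_ [x _]] := bB; apply: contrapT => nb.
have [p + pB] := unbounded_Bsharp hEc' x nb.
by rewrite -hB => /Bsharp_unbounded/(_ pB).
Qed.

Section Comparison.
Variables (X : Type) (Ec Ec' : set_system (X * X)).
Hypotheses (hEc : coarse_structure Ec) (hEc' : coarse_structure Ec').

Lemma parallel_eq_cover A B :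
    Bsharp Ec = Bsharp Ec' -> parallel Ec = parallel Ec' ->
    (exists2 E, Ec E & A `<=` eball E B) ->
  exists2 E, Ec' E & A `<=` eball E B.
Proof.
move=> hB hpar; have [B0|B0 [E _ AE]] := pselect (B !=set0).
  move/(eball_cover_parallel hEc A B0); rewrite hB hpar.
  by move/(eball_cover_parallel hEc' A B0).
have [E' Ec'E'] := coarse_neq0 hEc'.
by exists E' => // x /AE[b Bb]; case: B0; exists b.
Qed.

Lemma delta_sub :
    Bsharp Ec = Bsharp Ec' -> parallel Ec = parallel Ec' ->
  delta Ec `<=` delta Ec'.
Proof.
move=> hB hpar [A B] [E [/= EcE AE BE]].
have [|F Ec'F AF] := @parallel_eq_cover A B hB hpar; first by exists E.
have [|G Ec'G BG] := @parallel_eq_cover B A hB hpar; first by exists E.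
have [H Ec'H FGH] := coarse_supU hEc' Ec'F Ec'G.
exists H; split=> //= x.
- by move=> /AF/eballP[y By h]; apply/eballP; exists y => //; apply: FGH; left.
- by move=> /BG/eballP[y Ay h]; apply/eballP; exists y => //; apply: FGH; right.
Qed.

Lemma finite_Bsharp_sub :
    Bsharp Ec = Bsharp Ec' -> parallel Ec = parallel Ec' ->
    finite_set (Bsharp Ec) ->
  Ec `<=` Ec'.
Proof.
move=> hB hpar finB E EcE; apply: contrapT => nE.
have dE := coarse_diag hEc EcE.
pose R := filter_from Ec' (fun F => E `\` F).
have RF : ProperFilter R.
  apply: filter_from_proper => [|F Ec'F].
    apply: filter_from_filter => [|F G Ec'F Ec'G]; first exact: coarse_neq0.
    have [H Ec'H FGH] := coarse_supU hEc' Ec'F Ec'G.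
    exists H => // z [Ez nHz].
    by split; split=> // h; apply/nHz/FGH; [left|right].
  apply: contrapT => E0; apply/nE/(coarse_down hEc' Ec'F) => // z Ez.
  by apply: contrapT => nFz; apply: E0; exists z.
have [r [rU Rr]] := ultraFilterLemma RF.
have rE : r E.
  have [F Ec'F] := coarse_neq0 hEc'.
  by apply: Rr; exists F => // z [].
have nr F : Ec' F -> ~ r F.
  move=> Ec'F rF; have rnF : r (E `\` F) by apply: Rr; exists F.
  by have [z [? []]] := ultra_disjoint rU rF rnF.
pose p := [set A | r (fst @^-1` A)]; pose q := [set A | r (snd @^-1` A)].
have pU : UltraFilter p := ultra_fmap fst rU.
have qU : UltraFilter q := ultra_fmap snd rU.
have Epq P : p P -> q (eball E P).
  move=> rP; apply: (@filterS _ r _ _ _ _ (filterI (rP : r (fst @^-1` P)) rE)).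
  by move=> [x y] [/= Px xEy]; apply/eballP; exists x.
(* If [p] contained a bounded [D], then [r] would contain the part of [E] over [D]. That part lies
   in the square of a bounded set, hence in a member of [Ec']. *)
have Bp : Bsharp Ec p.
  split=> // D bD; have [rD|//] := in_ultra_setVsetC D pU.
  have bD' := bounded_setU hEc bD (bounded_eball hEc EcE bD).
  have [F Ec'F DF] := bounded_setX hEc' (Bsharp_eq_bounded hEc' hB bD').
  case: (nr F Ec'F).
  apply: (@filterS _ r _ _ _ _ (filterI (rD : r (fst @^-1` D)) rE)).
  move=> [x y] [/= Dx xEy].
  by apply: DF; split; [left|right; apply/eballP; exists x].
have Bq : Bsharp Ec q := Bsharp_transfer hEc EcE Bp qU Epq.
have : parallel Ec (p, q) by split=> //; exists E.
rewrite hpar => -[_ _ [G /= [Ec'G Gpq]]].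
have [Q qQ isoQ] : exists2 Q, q Q & forall q', Bsharp Ec q' -> q' Q -> q' = q.
  by apply: ultra_isolated => // q' [].
have Qdec := isolated_indecomposable hEc Bq qQ isoQ.
(* [F] mixes both structures and need not belong to either; it preserves boundedness because each
   factor does and the bounded sets agree. The union with the inverse makes it symmetric. *)
pose F := (G \; E^-1) `|` (G \; E^-1)^-1.
have Fb B : bounded_in Ec B -> bounded_in Ec (eball F B).
  move=> bB.
  have Gb H C : Ec' H -> bounded_in Ec C -> bounded_in Ec (eball H C).
    move=> Ec'H /(Bsharp_eq_bounded hEc' hB) bC.
    apply: (Bsharp_eq_bounded hEc (esym hB)).
    exact: (bounded_eball hEc').
  have bEB := bounded_eball hEc (coarse_inv hEc EcE) bB.
  have bGB := Gb _ _ (coarse_inv hEc' Ec'G) bB.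
  have bEGB := bounded_eball hEc EcE bGB.
  apply: bounded_sub (bounded_setU hEc (Gb _ _ Ec'G bEB) bEGB).
  move=> y /eballP[b Bb [[x xEb xGy]|[x xEy xGb]]]; [left|right].
  - by apply/eballP; exists x => //; apply/eballP; exists b.
  - by apply/eballP; exists x => //; apply/eballP; exists b.
have Fsym x y : F (x, y) -> F (y, x) by case; [right|left].
pose M := [set y | Q y /\ exists z, [/\ Q z, z <> y & F (y, z)]].
have bM : bounded_in Ec M by exact: indecomposable_moved_bounded.
have rQ : r (snd @^-1` (Q `\` M)).
  by apply: (filterI (F := q)) => //; exact: Bq.2.
have rG : r (fst @^-1` eball G^-1 Q) by exact: (eball_inv pU qU Gpq).
have rEGQ : r (E `&` (fst @^-1` eball G^-1 Q `&` snd @^-1` (Q `\` M))).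
  by apply: filterI => //; exact: filterI.
apply: (nr G Ec'G); apply: filterS rEGQ.
move=> -[x y] [xEy [/eballP[y' Qy' xGy'] [/= Qy nMy]]].
(* Both [y] and [y'] lie in [Q] and are linked through [x], so [y' <> y] would put [y] in [M]. *)
have [<-//|y'y] := pselect (y' = y).
by case: nMy; split=> //; exists y'; split=> //; left; exists x.
Qed.

End Comparison.

Theorem theorem13 (X : Type) (Ec Ec' : set_system (X * X)%type)
    (hEc : coarse_structure Ec) (hEc' : coarse_structure Ec')
    (hB : Bsharp Ec = Bsharp Ec') (hpar : parallel Ec = parallel Ec') :
  delta_equivalent Ec Ec' /\ (finite_set (Bsharp Ec) -> Ec = Ec').
Proof.
split=> [|finB]; apply/seteqP; split.
- exact: delta_sub.
- exact: delta_sub.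
- exact: finite_Bsharp_sub.
- by apply: finite_Bsharp_sub => //; rewrite -hB.
Qed.
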